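(* For every nonnegative integer $n$ and every integer $p>0$: $$\sum_{k=0}^n \frac{1}{k+p}H_k = H_{n+p}\,(H_{n+1}+H_{p-1}) - \frac{1}{2}\left[ (H_{n+1}+H_{p-1})^2 + H_{n+1}^{(2)} + H_{p-1}^{(2)} \right] - \sum_{k=0}^{p-2} \frac{1}{n+k+2} H_k .$$
   Context: For a nonnegative integer $n$ and a positive integer $m$, the generalized harmonic number is $H_n^{(m)} = \sum_{k=1}^n \frac{1}{k^m}$, so that $H_0^{(m)}=0$. The traditional harmonic number is $H_n = H_n^{(1)}$. Powers such as $(\cdot)^2$ and $H_n^2$ denote ordinary squares, while the parenthesized superscript in $H_n^{(2)}$ denotes the order. Empty sums (upper limit less than lower limit) are zero. *)

(* Defs.v *)
From mathcomp Require Import all_boot all_order all_algebra.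

Set Implicit Arguments.
Unset Strict Implicit.
Unset Printing Implicit Defensive.

Import GRing.Theory.
Local Open Scope ring_scope.

(* The generalized harmonic number H_n^(m), used for m > 0. *)
Definition gharmonic (m n : nat) : rat :=
  \sum_(1 <= k < n.+1) 1 / k%:R ^+ m.

Definition harmonic (n : nat) : rat := gharmonic 1 n.

(* Main.v *)
Require Import Defs.
From mathcomp Require Import all_boot all_order all_algebra.
From mathcomp Require Import ring.

(** Put [N = n + 1] and [q = p - 1].  Moving the last sum to the left turns the
    identity into one that is symmetric in [N] and [q]:
    [F N q + F q N = H_(N+q) (H_N + H_q)
                     - 1/2 ((H_N + H_q)^2 + H_N^(2) + H_q^(2))],
    where [F N q] is the sum of [H_k / (k + q + 1)] over [k < N].

    It is proved by induction on [N].  Passing from [N] to [N + 1] adds one term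
    to [F N q] and shifts every denominator of [F q N]; the effect of that shift
    is computed in closed form by summation by parts
    ([weighted_harmonic_sum_shift]).  Both sides then grow by the same amount
    ([symmetrized_sum_step]).  The base case [N = 0] is, by symmetry, the case
    [q = 0] of the same identity, so it follows from the same step, started
    from the trivial case [N = q = 0]. *)

Set Implicit Arguments.
Unset Strict Implicit.
Unset Printing Implicit Defensive.

Import GRing.Theory.
Local Open Scope ring_scope.

Lemma gharmonic0 m : gharmonic m 0 = 0.
Proof. by rewrite /gharmonic big_geq. Qed.

Lemma gharmonicS m n : gharmonic m n.+1 = gharmonic m n + 1 / n.+1%:R ^+ m.
Proof. by rewrite /gharmonic big_nat_recr. Qed.

Lemma harmonicS n : harmonic n.+1 = harmonic n + 1 / n.+1%:R.
Proof. by rewrite /harmonic gharmonicS expr1. Qed.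

Definition weighted_harmonic_sum (N q : nat) : rat :=
  \sum_(0 <= k < N) 1 / (k + q).+1%:R * harmonic k.

Lemma weighted_harmonic_sum0 q : weighted_harmonic_sum 0 q = 0.
Proof. by rewrite /weighted_harmonic_sum big_geq. Qed.

Lemma weighted_harmonic_sumS N q :
  weighted_harmonic_sum N.+1 q =
    weighted_harmonic_sum N q + 1 / (N + q).+1%:R * harmonic N.
Proof. by rewrite /weighted_harmonic_sum big_nat_recr. Qed.

Lemma partial_fractions (q N : nat) :
  1 / q.+1%:R * (1 / (q + N.+1).+1%:R) =
    1 / N.+1%:R * (1 / q.+1%:R - 1 / (q + N.+1).+1%:R) :> rat.
Proof.
have sumE : (q + N.+1).+1%:R = q.+1%:R + N.+1%:R :> rat by rewrite -natrD addSn.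
have nz k : k.+1%:R != 0 :> rat by rewrite Num.Theory.pnatr_eq0.
move: (nz (q + N.+1)) (nz q) (nz N); rewrite sumE.
set x := q.+1%:R; set y := N.+1%:R; clearbody x y => xy0 x0 y0.
by field; rewrite xy0 x0 y0.
Qed.

(** Summation by parts against the differences of [1 / (k + N + 1)]: the
    boundary term is [H_q / (q + N + 1)], and the remaining sum of
    [1 / ((k + 1) (k + N + 2))] over [k < q] splits by partial fractions into
    [1 / (N + 1)] times a combination of harmonic numbers. *)
Lemma weighted_harmonic_sum_shift q N :
  weighted_harmonic_sum q N.+1 - weighted_harmonic_sum q N =
    1 / (q + N).+1%:R * harmonic q
    - 1 / N.+1%:R * (harmonic q + harmonic N.+1 - harmonic (q + N).+1).
Proof.
elim: q => [|q IHq].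
  by rewrite !weighted_harmonic_sum0 /harmonic gharmonic0 add0n; ring.
have pf := partial_fractions q N.
rewrite !weighted_harmonic_sumS harmonicS addSn (harmonicS (q + N).+1).
rewrite addnS in pf *.
move: IHq pf.
set a := 1 / N.+1%:R; set c := 1 / q.+1%:R.
set b := 1 / (q + N).+1%:R; set d := 1 / (q + N).+2%:R => IHq pf.
transitivity (weighted_harmonic_sum q N.+1 - weighted_harmonic_sum q N
              + (d - b) * harmonic q); first by ring.
rewrite IHq.
transitivity (d * harmonic q + a * (c - d) - a * (harmonic q + c
  + harmonic N.+1 - (harmonic (q + N).+1 + d))); first by ring.
by rewrite -pf; ring.
Qed.

Definition harmonic_closed_form (N q : nat) : rat :=
  harmonic (N + q) * (harmonic N + harmonic q)
  - 1 / 2 * ((harmonic N + harmonic q) ^+ 2 + gharmonic 2 N + gharmonic 2 q).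

Lemma harmonic_closed_formC N q :
  harmonic_closed_form N q = harmonic_closed_form q N.
Proof. by rewrite /harmonic_closed_form (addnC q); ring. Qed.

(** The increments in [N] of the two sides agree.  With [a = 1 / (N + 1)],
    [b = 1 / (N + q + 1)], [s = H_N + H_q] and [h = H_(N+q)], both are equal to
    [b s - a (s + a - h - b)]. *)
Lemma symmetrized_sum_step N q :
  weighted_harmonic_sum N q + weighted_harmonic_sum q N =
    harmonic_closed_form N q ->
  weighted_harmonic_sum N.+1 q + weighted_harmonic_sum q N.+1 =
    harmonic_closed_form N.+1 q.
Proof.
move=> IH; have shift := weighted_harmonic_sum_shift q N.
rewrite weighted_harmonic_sumS.
rewrite -[weighted_harmonic_sum q N.+1](subrK (weighted_harmonic_sum q N)).
rewrite shift (addnC q N).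
transitivity (weighted_harmonic_sum N q + weighted_harmonic_sum q N
  + 1 / (N + q).+1%:R * (harmonic N + harmonic q)
  - 1 / N.+1%:R * (harmonic q + harmonic N.+1 - harmonic (N + q).+1)).
  by ring.
rewrite IH /harmonic_closed_form addSn !harmonicS gharmonicS.
have -> : 1 / N.+1%:R ^+ 2 = (1 / N.+1%:R) ^+ 2 :> rat.
  by rewrite expr_div_n expr1n.
set a := 1 / N.+1%:R; set b := 1 / (N + q).+1%:R.
by field.
Qed.

Lemma symmetrized_sum N q :
  weighted_harmonic_sum N q + weighted_harmonic_sum q N =
    harmonic_closed_form N q.
Proof.
elim: N => [|N IHN]; last exact: symmetrized_sum_step.
rewrite addrC harmonic_closed_formC.
elim: q => [|q IHq]; last exact: symmetrized_sum_step.
by rewrite weighted_harmonic_sum0 /harmonic_closed_form /harmonic !gharmonic0;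
   ring.
Qed.

Theorem theorem2p1 (n p : nat) (hp : (0 < p)%N) :
  \sum_(0 <= k < n.+1) 1 / (k + p)%:R * harmonic k =
    harmonic (n + p) * (harmonic (n + 1) + harmonic (p - 1))
    - 1 / 2 * ((harmonic (n + 1) + harmonic (p - 1)) ^+ 2
               + gharmonic 2 (n + 1) + gharmonic 2 (p - 1))
    - \sum_(0 <= k < p - 1) 1 / (n + k + 2)%:R * harmonic k.
Proof.
case: p hp => // q _; rewrite subn1 addn1 /= -addSnnS.
rewrite -/(harmonic_closed_form n.+1 q) -symmetrized_sum.
have -> : \sum_(0 <= k < q) 1 / (n + k + 2)%:R * harmonic k =
          weighted_harmonic_sum q n.+1.
  by apply: eq_bigr => k _; rewrite addn2 (addnC n) addnS.
by rewrite addrK; apply: eq_bigr => k _; rewrite addnS.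
Qed.
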